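(* Suppose that the reference element $\hat K$ is taken to be equilateral and unitary in volume. Let $\theta_K>0$ ($K\in\mathcal{T}_h$) be an arbitrary piecewise constant function, and let $\mathcal{T}_h$ be an $M$-uniform simplicial mesh of $\Omega$ associated with the metric tensor $$M_K=\theta_K\,\mathbb{D}_K^{-1},\qquad\forall K\in\mathcal{T}_h .$$ Then the linear finite element scheme for the boundary value problem $-\nabla\cdot(\mathbb{D}\nabla u)=f$ in $\Omega$, $u=g$ on $\partial\Omega$ (as defined in the context, with quadrature) satisfies the discrete maximum principle (DMP).
   Context: Problem. $d\in\{1,2,3\}$; $\Omega\subset\mathbb{R}^d$ is a connected (bounded) interval, polygon or polyhedron; $f$ and $g$ are given functions; $\mathbb{D}=\mathbb{D}(\boldsymbol{x})$ is a $d\times d$ diffusion matrix, symmetric and strictly positive definite on $\Omega$. The boundary value problem is $-\nabla\cdot(\mathbb{D}\nabla u)=f$ in $\Omega$, $u=g$ on $\partial\Omega$. Mesh. $\mathcal{T}_h$ is a simplicial triangulation of $\Omega$ with $N$ elements and $N_v$ vertices $\boldsymbol{a}_1,\dots,\boldsymbol{a}_{N_v}$, ordered so that the first $N_{vi}$ are the interior ones and the remaining ones lie on $\partial\Omega$. $\phi_j$ is the continuous piecewise linear basis function of the vertex $\boldsymbol{a}_j$. $\hat K$ is a fixed reference simplex; for $K\in\mathcal{T}_h$, $F_K$ is the affine map with $K=F_K(\hat K)$ and $F_K'$ is its (constant) Jacobian matrix; $|K|$ is the volume of $K$. Quadrature. A quadrature rule $\int_{\hat K} v\,d\xi\approx|\hat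 K|\sum_{k=1}^m\hat w_k v(\hat b_k)$ on $\hat K$, with weights $\hat w_k$ satisfying $\sum_{k=1}^m\hat w_k=1$ and quadrature nodes $\hat b_k$, is fixed. Put $b_k^K=F_K(\hat b_k)$ and $\mathbb{D}_K=\sum_{k=1}^m\hat w_k\,\mathbb{D}(b_k^K)$. Scheme. Let $U_0^h=\mathrm{span}\{\phi_1,\dots,\phi_{N_{vi}}\}$. The linear finite element scheme is: find $u^h=\sum_{j=1}^{N_v}u_j\phi_j$ with $u_j=g(\boldsymbol{a}_j)$ for $j=N_{vi}+1,\dots,N_v$ such that $$\sum_{K\in\mathcal{T}_h}|K|\,(\nabla v^h|_K)^T\mathbb{D}_K\nabla u^h|_K=\sum_{K\in\mathcal{T}_h}|K|\sum_{k=1}^m\hat w_k f(b_k^K)\,v^h(b_k^K)\qquad\forall v^h\in U_0^h.$$ DMP. The discrete maximum principle is the discrete counterpart of the maximum principle of the continuous problem: whenever $f(\boldsymbol{x})\le0$ for all $\boldsymbol{x}\in\Omega$, the solution of the scheme satisfies $\max_{\boldsymbol{x}\in\Omega\cup\partial\Omega}u^h(\boldsymbol{x})\le\max\{0,\max_{\boldsymbol{s}\in\partial\Omega}u^h(\boldsymbol{s})\}$. $M$-uniform mesh. Given symmetric positive definite matrices $M_K$, $K\in\mathcal{T}_h$ (the element averages of a metric tensor $M$), put $\rho_K=\sqrt{\det(M_K)}$ and $\sigma_h=\sum_{K\in\mathcal{T}_h}\rho_K|K|$. An $M$-uniform simplicial mesh $\mathcal{T}_h$ (a uniform mesh in the metric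 specified by $M$) is characterized by the equidistribution condition $\rho_K|K|=\sigma_h/N$ for all $K\in\mathcal{T}_h$ and the alignment condition $\frac1d\,\mathrm{tr}\big((F_K')^TM_KF_K'\big)=\det\big((F_K')^TM_KF_K'\big)^{1/d}$ for all $K\in\mathcal{T}_h$.
   Formalization: The quadrature weights are assumed nonnegative in addition to summing to 1; with a negative weight the claim fails (d=1, D=1, g=0, weights 1,1,-1, f≤0 nonzero only near the nodes of negative weight gives a positive solution inside). *)

(* Defs.v *)
From HB Require Import structures.
From mathcomp Require Import all_boot all_order all_algebra.
From mathcomp Require Import all_classical all_reals all_analysis.
Set Implicit Arguments.
Unset Strict Implicit.
Unset Printing Implicit Defensive.
Import Order.TTheory GRing.Theory Num.Theory.
Import numFieldNormedType.Exports.
Local Open Scope classical_set_scope.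
Local Open Scope ring_scope.

Definition dotv (R : realType) (d : nat) (x y : 'cV[R]_d) : R :=
  (x^T *m y) 0 0.

(* Euclidean length; the library norm on matrices is the sup norm. *)
Definition enorm (R : realType) (d : nat) (x : 'cV[R]_d) : R :=
  Num.sqrt (dotv x x).

Definition spd (R : realType) (d : nat) (A : 'M[R]_d) : Prop :=
  A^T = A /\ forall x : 'cV[R]_d, x != 0 -> 0 < dotv x (A *m x).

Definition boundary (T : topologicalType) (A : set T) : set T :=
  closure A `\` interior A.

Definition is_max (T : Type) (R : realType) (A : set T) (v : T -> R) (m : R)
  : Prop :=
  (exists2 x, A x & v x = m) /\ (forall x, A x -> v x <= m).

Definition grad (R : realType) (d : nat) (v : 'cV[R]_d -> R) (x : 'cV[R]_d)
  : 'cV[R]_d :=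
  \col_i 'D_(delta_mx i 0 : 'cV[R]_d) v x.

Definition hull (R : realType) (d : nat) (I : finType) (S : {set I})
    (p : I -> 'cV[R]_d) : set 'cV[R]_d :=
  [set x | exists l : I -> R,
     [/\ forall i, i \in S -> 0 <= l i,
         \sum_(i in S) l i = 1 &
         x = \sum_(i in S) l i *: p i]].

Definition simplex (R : realType) (d : nat) (p : 'I_d.+1 -> 'cV[R]_d)
  : set 'cV[R]_d := hull [set: 'I_d.+1] p.

(* Column j is p_(j+1) - p_0. *)
Definition edge_mx (R : realType) (d : nat) (p : 'I_d.+1 -> 'cV[R]_d)
  : 'M[R]_d :=
  \matrix_(i, j) (p (lift ord0 j) i 0 - p ord0 i 0).

(* The d-dimensional volume of a simplex, |det(p_1 - p_0, ..., p_d - p_0)| / d!;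
   the library has Lebesgue measure on the line only. *)
Definition volume (R : realType) (d : nat) (p : 'I_d.+1 -> 'cV[R]_d) : R :=
  `|\det (edge_mx p)| / (d`!)%:R.

Definition barycenter (R : realType) (d : nat) (p : 'I_d.+1 -> 'cV[R]_d)
  : 'cV[R]_d :=
  (d.+1%:R)^-1 *: \sum_i p i.

Definition equilateral (R : realType) (d : nat) (p : 'I_d.+1 -> 'cV[R]_d)
  : Prop :=
  exists l : R, forall i j, i != j -> enorm (p i - p j) = l.

(* Bounded open interval (d = 1), polygon (d = 2) or polyhedron (d = 3),
   connected, not necessarily convex or simply connected. Taking the interior
   of the union excludes slits and punctures. *)
Definition polytopal_domain (R : realType) (d : nat) (Omega : set 'cV[R]_d)
  : Prop :=
  [/\ Omega !=set0, connected Omega &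
      exists (n : nat) (p : 'I_n -> 'I_d.+1 -> 'cV[R]_d),
        (forall i, 0 < volume (p i)) /\
        Omega = interior (\bigcup_i simplex (p i))].

(* [local T K] lists the (global indices of the) d + 1 vertices of K. *)
Record mesh (R : realType) (d : nat) := Mesh {
  nvert : nat;
  nivert : nat;
  nelt : nat;
  vertex : 'I_nvert -> 'cV[R]_d;
  local : 'I_nelt -> 'I_d.+1 -> 'I_nvert
}.

Definition eltv (R : realType) (d : nat) (T : mesh R d) (K : 'I_(nelt T))
  : 'I_d.+1 -> 'cV[R]_d := fun i => vertex (local K i).

Definition elt (R : realType) (d : nat) (T : mesh R d) (K : 'I_(nelt T))
  : set 'cV[R]_d := simplex (eltv K).

Definition elt_vol (R : realType) (d : nat) (T : mesh R d) (K : 'I_(nelt T))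
  : R := volume (eltv K).

Definition vset (R : realType) (d : nat) (T : mesh R d) (K : 'I_(nelt T))
  : {set 'I_(nvert T)} := [set local K i | i : 'I_d.+1].

Record triangulation (R : realType) (d : nat) (Omega : set 'cV[R]_d)
    (T : mesh R d) : Prop := Triangulation {
  vertex_inj : injective (@vertex R d T);
  vset_inj : injective (@vset R d T);
  elt_nondegenerate : forall K : 'I_(nelt T), 0 < elt_vol K;
  elt_cover : \bigcup_(K : 'I_(nelt T)) elt K = closure Omega;
  (* K and K' are disjoint or meet in a common face *)
  elt_conforming : forall K K' : 'I_(nelt T),
    elt K `&` elt K' = hull (vset K :&: vset K') (@vertex R d T);
  vertex_used : forall j : 'I_(nvert T), exists K, j \in vset K;
  nivert_le : (nivert T <= nvert T)%N;
  vertex_interior : forall j : 'I_(nvert T), (j < nivert T)%N ->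
    Omega (vertex j);
  vertex_boundary : forall j : 'I_(nvert T), (nivert T <= j)%N ->
    boundary Omega (vertex j)
}.

Definition affine_on (R : realType) (d : nat) (A : set 'cV[R]_d)
    (v : 'cV[R]_d -> R) : Prop :=
  exists (q : 'cV[R]_d) (c : R), forall x, A x -> v x = dotv q x + c.

Definition nodal_basis (R : realType) (d : nat) (Omega : set 'cV[R]_d)
    (T : mesh R d) (phi : 'I_(nvert T) -> 'cV[R]_d -> R) : Prop :=
  forall j,
    [/\ {within closure Omega, continuous (phi j)},
        forall K : 'I_(nelt T), affine_on (elt K) (phi j) &
        forall i, phi j (vertex i) = (i == j)%:R].

(* The constant gradient on K of a piecewise linear function. *)
Definition elt_grad (R : realType) (d : nat) (T : mesh R d)
    (v : 'cV[R]_d -> R) (K : 'I_(nelt T)) : 'cV[R]_d :=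
  grad v (barycenter (eltv K)).

Definition affine_map (R : realType) (d : nat) (B : 'M[R]_d) (c : 'cV[R]_d)
  : 'cV[R]_d -> 'cV[R]_d := fun x => B *m x + c.

Section MUniform.
Variables (R : realType) (d : nat) (T : mesh R d).
Variables (M : 'I_(nelt T) -> 'M[R]_d) (B : 'I_(nelt T) -> 'M[R]_d).

Definition rho (K : 'I_(nelt T)) : R := Num.sqrt (\det (M K)).

Definition sigma : R := \sum_(K < nelt T) rho K * elt_vol K.

Definition equidistribution : Prop :=
  forall K : 'I_(nelt T), rho K * elt_vol K = sigma / (nelt T)%:R.

Definition alignment : Prop :=
  forall K : 'I_(nelt T),
    (d%:R)^-1 * \tr ((B K)^T *m M K *m B K) =
    (\det ((B K)^T *m M K *m B K)) `^ (d%:R)^-1.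

(* B K is the Jacobian matrix of F_K. *)
Definition M_uniform : Prop :=
  [/\ forall K, spd (M K), equidistribution & alignment].

End MUniform.

Section Scheme.
Variables (R : realType) (d : nat) (Omega : set 'cV[R]_d) (T : mesh R d).
Variable phi : 'I_(nvert T) -> 'cV[R]_d -> R.
Variables (B : 'I_(nelt T) -> 'M[R]_d) (c : 'I_(nelt T) -> 'cV[R]_d).
Variables (m : nat) (w : 'I_m -> R) (bhat : 'I_m -> 'cV[R]_d).
Variables (D : 'cV[R]_d -> 'M[R]_d) (f g : 'cV[R]_d -> R).

Definition qnode (K : 'I_(nelt T)) (k : 'I_m) : 'cV[R]_d :=
  affine_map (B K) (c K) (bhat k).

Definition avg_diffusion (K : 'I_(nelt T)) : 'M[R]_d :=
  \sum_k w k *: D (qnode K k).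

Definition fe_fun (u : 'I_(nvert T) -> R) : 'cV[R]_d -> R :=
  fun x => \sum_j u j * phi j x.

Definition U0 : set ('cV[R]_d -> R) :=
  [set v | exists a : 'I_(nvert T) -> R,
     v = (fun x => \sum_(j < nvert T | (j < nivert T)%N) a j * phi j x)].

Definition fe_solution (u : 'I_(nvert T) -> R) : Prop :=
  (forall j : 'I_(nvert T), (nivert T <= j)%N -> u j = g (vertex j)) /\
  forall v, U0 v ->
    \sum_(K < nelt T)
       elt_vol K *
         dotv (elt_grad v K) (avg_diffusion K *m elt_grad (fe_fun u) K) =
    \sum_(K < nelt T)
       elt_vol K * \sum_k w k * f (qnode K k) * v (qnode K k).

(* max over (Omega u bd Omega) of uh <= max {0, max over bd Omega of uh},
   both maxima being attained. *)
Definition max_principle (uh : 'cV[R]_d -> R) : Prop :=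
  exists mx mb : R,
    [/\ is_max (Omega `|` boundary Omega) uh mx,
        is_max (boundary Omega) uh mb &
        mx <= Num.max 0 mb].

Definition satisfies_DMP : Prop :=
  (forall x, Omega x -> f x <= 0) ->
  forall u, fe_solution u -> max_principle (fe_fun u).

End Scheme.

(* Main.v *)
Require Import Defs.
From HB Require Import structures.
From mathcomp Require Import all_boot all_order all_algebra.
From mathcomp Require Import all_classical all_reals all_analysis.
From mathcomp Require Import ring lra.
Set Implicit Arguments.
Unset Strict Implicit.
Unset Printing Implicit Defensive.
Import Order.TTheory GRing.Theory Num.Theory.
Import numFieldNormedType.Exports.
Local Open Scope classical_set_scope.
Local Open Scope ring_scope.

(** Alignment says that the symmetric positive definite matrix
    B_K^T M_K B_K has equal arithmetic and geometric mean of eigenvalues, so it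
    is a multiple of the identity.  With M_K = theta_K D_K^-1 this makes D_K a
    positive multiple of B_K B_K^T ([aligned_diffusion]): the diffusion matrix
    is, up to a factor, the one that the affine map F_K transports from the
    identity on the reference simplex.  Products of gradients of barycentric
    coordinates in the D_K metric are therefore, up to that factor, the
    Euclidean ones on the reference simplex, and on an equilateral simplex the
    gradients of two different coordinates make an obtuse angle
    ([dotv_bgrad_equilateral_lt0]).  So two different vertices of an element
    contribute a negative off-diagonal entry to the stiffness matrix
    ([M_uniform_strongly_acute]).

    Testing the scheme with the basis function of an interior vertex bounds the
    corresponding row of the stiffness matrix applied to u by the load, which is
    at most 0.  Rows sum to zero, so if u is maximal at an interior vertex it
    takes the same value at all vertices of the elements around it
    ([max_at_neighbours]).  This leads to the boundary in one step: among all
    the vertices where u is maximal, take one that is extreme in a fixed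
    direction.  The elements around an interior vertex contain a
    neighbour further in that direction ([star_ascent]), so the chosen vertex
    lies on the boundary ([max_at_boundary_vertex]).  A piecewise linear
    function attains its maximum at a vertex, hence the maximum over the closed
    domain is attained on the boundary.

    The sign of the load needs some geometry, because the quadrature nodes may
    lie on the boundary of the domain, where f can be positive.  The basis
    function of an interior vertex vanishes at such nodes: the points where it
    is positive are interior to the domain ([open_star_sub]). *)

(** * Dot product *)

Section DotProduct.
Variables (R : realType) (n : nat).
Implicit Types (x y z : 'cV[R]_n).

Lemma dotvE x y : dotv x y = \sum_i x i 0 * y i 0.
Proof. by rewrite /dotv mxE; apply: eq_bigr => i _; rewrite mxE. Qed.

Lemma dotvC x y : dotv x y = dotv y x.
Proof. by rewrite !dotvE; apply: eq_bigr => i _; rewrite mulrC. Qed.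

Lemma dotvDr x y z : dotv x (y + z) = dotv x y + dotv x z.
Proof. by rewrite /dotv mulmxDr mxE. Qed.

Lemma dotvZr a x y : dotv x (a *: y) = a * dotv x y.
Proof. by rewrite /dotv -scalemxAr mxE. Qed.

Lemma dotvNr x y : dotv x (- y) = - dotv x y.
Proof. by rewrite -scaleN1r dotvZr mulN1r. Qed.

Lemma dotvBr x y z : dotv x (y - z) = dotv x y - dotv x z.
Proof. by rewrite dotvDr dotvNr. Qed.

Lemma dotvZl a x y : dotv (a *: x) y = a * dotv x y.
Proof. by rewrite dotvC dotvZr dotvC. Qed.

Lemma dotvBl x y z : dotv (x - y) z = dotv x z - dotv y z.
Proof. by rewrite dotvC dotvBr !(dotvC z). Qed.

Lemma dotv0r x : dotv x 0 = 0.
Proof. by rewrite -(scale0r 0) dotvZr mul0r. Qed.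

Lemma dotv_sumr (I : Type) (s : seq I) (P : pred I) x (F : I -> 'cV[R]_n) :
  dotv x (\sum_(i <- s | P i) F i) = \sum_(i <- s | P i) dotv x (F i).
Proof. exact: (big_morph _ (dotvDr x) (dotv0r x)). Qed.

Lemma dotv_suml (I : Type) (s : seq I) (P : pred I) x (F : I -> 'cV[R]_n) :
  dotv (\sum_(i <- s | P i) F i) x = \sum_(i <- s | P i) dotv (F i) x.
Proof. by rewrite dotvC dotv_sumr; apply: eq_bigr => i _; rewrite dotvC. Qed.

Lemma dotv_delta x i : dotv x (delta_mx i 0) = x i 0.
Proof.
rewrite dotvE (bigD1 i)//= big1 ?addr0 => [|j ji]; rewrite mxE ?(negPf ji).
  by rewrite !eqxx mulr1.
by rewrite mulr0.
Qed.

Lemma dotvv_ge0 x : 0 <= dotv x x.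
Proof. by rewrite dotvE sumr_ge0// => i _; rewrite -expr2 sqr_ge0. Qed.

Lemma dotvv_eq0 x : (dotv x x == 0) = (x == 0).
Proof.
apply/eqP/eqP => [|->]; last exact: dotv0r.
rewrite dotvE => /psumr_eq0P x0; apply/matrixP => i j; rewrite (ord1 j) mxE.
by apply/eqP; rewrite -sqrf_eq0 expr2 x0// => k _; rewrite -expr2 sqr_ge0.
Qed.

End DotProduct.

Lemma dotv_mulmxr (R : realType) (m n : nat) (A : 'M[R]_(m, n))
    (x : 'cV[R]_m) (y : 'cV[R]_n) : dotv x (A *m y) = dotv (A^T *m x) y.
Proof. by rewrite /dotv trmx_mul trmxK mulmxA. Qed.

(** * Trace and determinant of positive definite matrices *)

Section PositiveDefinite.
Variable R : realType.

Lemma spd_unitmx (n : nat) (A : 'M[R]_n) : spd A -> A \in unitmx.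
Proof.
case=> Asym Apos; rewrite -row_free_unit -kermx_eq0; apply: contraT.
case/rowV0Pn => v /sub_kermxP vA v0.
have := Apos v^T; rewrite -(inj_eq (@trmx_inj _ _ _)) trmxK trmx0 => /(_ v0).
by rewrite /dotv trmxK mulmxA vA mul0mx mxE ltxx.
Qed.

Lemma spd_congr (n : nat) (A P : 'M[R]_n) :
  P \in unitmx -> spd A -> spd (P^T *m A *m P).
Proof.
move=> Pu [Asym Apos]; split; first by rewrite !trmx_mul trmxK Asym mulmxA.
move=> x x0; rewrite -!mulmxA dotv_mulmxr trmxK; apply: Apos.
by apply: contra x0 => /eqP Px; rewrite -(mulKmx Pu x) Px mulmx0.
Qed.

Lemma spd_diag_gt0 (n : nat) (A : 'M[R]_n) i : spd A -> 0 < A i i.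
Proof.
case=> _ /(_ (delta_mx i 0)) Apos.
have <- : dotv (delta_mx i 0) (A *m delta_mx i 0) = A i i.
  by rewrite dotvC dotv_delta -colE mxE.
apply: Apos; apply/eqP => /matrixP/(_ i 0); rewrite !mxE !eqxx => /eqP.
by rewrite oner_eq0.
Qed.

(** The Schur complement of the corner a is the quadratic form of the block
    matrix restricted to the vectors whose first coordinate minimizes it. *)
Lemma spd_schur (n : nat) (a : R) (b : 'cV[R]_n) (C : 'M[R]_n) :
    spd (block_mx a%:M b^T b C) ->
  [/\ 0 < a, spd (C - a^-1 *: (b *m b^T)) &
      \det (block_mx a%:M b^T b C) = a * \det (C - a^-1 *: (b *m b^T))].
Proof.
move=> Aspd; have a0 : 0 < a.
  by have := spd_diag_gt0 (lshift n ord0) Aspd; rewrite block_mxEul mxE eqxx.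
have an0 : a != 0 by rewrite gt_eqF.
case: Aspd => Asym Apos; split => //.
  have Csym : C^T = C by move: Asym; rewrite tr_block_mx => /eq_block_mx[].
  split; first by rewrite linearB linearZ /= Csym trmx_mul trmxK.
  move=> x x0; set t := (b^T *m x) 0 0.
  (* The first coordinate -t/a makes the top entry of the image vanish. *)
  have := Apos (col_mx (- (a^-1 * t))%:M x).
  have btx : b^T *m x = t%:M by rewrite [LHS]mx11_scalar.
  have -> : dotv (col_mx (- (a^-1 * t))%:M x)
      (block_mx a%:M b^T b C *m col_mx (- (a^-1 * t))%:M x) =
      dotv x ((C - a^-1 *: (b *m b^T)) *m x).
    have top0 : a%:M *m (- (a^-1 * t))%:M + b^T *m x = 0.
      by rewrite btx -scalar_mxM mulrN mulVKf// -raddfD addNr raddf0.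
    rewrite mul_block_col top0 /dotv tr_col_mx mul_row_col mulmx0 add0r.
    congr ((_ *m _) 0 0); rewrite mulmxBl -scalemxAl -mulmxA btx addrC.
    by rewrite !mul_mx_scalar scalerA scaleNr.
  apply; apply: contra x0 => /eqP/(congr1 dsubmx).
  by rewrite col_mxKd linear0 => ->.
have -> : block_mx a%:M b^T b C =
    block_mx 1%:M 0 (a^-1 *: b) 1%:M *m
    block_mx a%:M b^T 0 (C - a^-1 *: (b *m b^T)).
  rewrite mulmx_block !mul1mx !mul0mx !addr0 -scalemxAl.
  by rewrite -scalemxAl mul_mx_scalar scalerA mulVf// scale1r addrC subrK.
by rewrite det_mulmx det_lblock det_ublock !det1 !mul1r det_scalar1.
Qed.

(** Hadamard's inequality with its equality case.  Passing to the Schur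
    complement S of the corner a divides the determinant by a and lowers the
    diagonal entries C i i by b_i^2 / a; so nothing is lost only if b = 0 and,
    inductively, S is diagonal. *)
Lemma hadamard (n : nat) (A : 'M[R]_n) : spd A ->
  0 < \det A /\ \det A <= \prod_i A i i ?= iff is_diag_mx A.
Proof.
elim: n A => [A _|n IHn A].
  rewrite det_mx00 big_ord0 ltr01; split=> //; apply/leifP.
  by case: ifP => // /negbT/negP[]; apply/is_diag_mxP => -[].
rewrite -[n.+1]/(1 + n)%N in A *.
rewrite -(submxK A); set b := dlsubmx A; set C := drsubmx A => Aspd.
have bE : ursubmx A = b^T.
  by case: Aspd; rewrite tr_block_mx => /eq_block_mx[_ _ <-]; rewrite trmxK.
move: Aspd; rewrite bE [ulsubmx A]mx11_scalar; set a := ulsubmx A 0 0 => Aspd.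
have [a0 Sspd ->] := spd_schur Aspd.
set S := _ - _ in Sspd *.
have [S0 hS] := IHn _ Sspd; split; first by rewrite mulr_gt0.
have CS i : S i i = C i i - a^-1 * b i 0 ^+ 2.
  by rewrite !mxE big_ord1 !mxE expr2.
have hC : \prod_i S i i <= \prod_i C i i ?= iff
    (\prod_i C i i == 0) || [forall (i | predT i), b i 0 == 0].
  apply: leif_pprod => i _; first by rewrite ltW// spd_diag_gt0.
  apply/leifP; case: eqVneq => [bi|bi]; rewrite CS.
    by rewrite bi expr0n mulr0 subr0.
  by rewrite ltrBlDr ltrDl mulr_gt0 ?invr_gt0// exprn_even_gt0.
have C0 : 0 < \prod_i C i i.
  apply: prodr_gt0 => i _.
  by have := spd_diag_gt0 (rshift 1 i) Aspd; rewrite block_mxEdr.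
rewrite big_split_ord big_ord1 /= !block_mxEul mxE eqxx mulr1n.
under eq_bigr do rewrite block_mxEdr.
rewrite (gt_eqF C0) /= in hC; have [hle heq] := leif_trans hS hC.
split; first by rewrite ler_pM2l.
rewrite (inj_eq (mulfI (lt0r_neq0 a0))) heq is_diag_block_mx// scalar_mx_is_diag.
rewrite trmx_eq0 /= andbA andbb.
have [b0|bn0] := eqVneq b 0; last first.
  apply/negbTE; apply: contra bn0 => /andP[_ /forallP b0].
  by apply/eqP/matrixP => i j; rewrite ord1 [RHS]mxE; have /eqP := b0 i.
have -> : S = C by rewrite /S b0 mul0mx scaler0 subr0.
by apply: andb_idr => _; apply/forallP => i; rewrite b0 mxE eqxx.
Qed.

(** The determinant is at most the product of the diagonal entries, which is at
    most the n-th power of their mean.  Equality in the first step makes A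
    diagonal, equality in the second makes its diagonal constant. *)
Lemma spd_trace_det_scalar (n : nat) (A : 'M[R]_n) : spd A ->
  (\tr A / n%:R) ^+ n <= \det A -> exists a, A = a%:M.
Proof.
move=> Aspd; have [_ hA] := hadamard Aspd.
have := @leif_AGM R 'I_n predT (fun i => A i i).
rewrite cardT size_enum_ord => /(_ (fun i _ => ltW (spd_diag_gt0 i Aspd))) hG.
have [Ale Aeq] := leif_trans hA hG.
rewrite -/(\tr A) => trA; move: Aeq; rewrite eq_le Ale trA => /esym/andP[].
move=> /is_diag_mxP Adiag /forallP Acst.
case: n A {Aspd hA hG Ale trA} Adiag Acst => [|n] A Adiag Acst.
  by exists 0; rewrite !thinmx0.
exists (A 0 0); apply/matrixP => i j; rewrite mxE; case: eqVneq => [<-|ij].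
  by have /forallP/(_ 0)/eqP := Acst i.
by rewrite Adiag.
Qed.

End PositiveDefinite.

(** * Barycentric coordinates of a nondegenerate simplex *)

Section Barycentric.
Variables (R : realType) (d : nat).
Implicit Types (p : 'I_d.+1 -> 'cV[R]_d) (x y : 'cV[R]_d).

(** The gradient of the i-th barycentric coordinate.  For i = k + 1 it is a row
    of the inverse edge matrix, the dual basis of the edges leaving p_0; the
    gradients add up to zero, which determines the one for i = 0. *)
Definition bgrad p (i : 'I_d.+1) : 'cV[R]_d :=
  if unlift ord0 i is Some k then (row k (invmx (edge_mx p)))^T
  else - \sum_k (row k (invmx (edge_mx p)))^T.

Definition bary p (i : 'I_d.+1) x : R :=
  (i == ord0)%:R + dotv (bgrad p i) (x - p ord0).

Lemma volume_unitmx p : 0 < volume p -> edge_mx p \in unitmx.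
Proof.
rewrite unitmxE unitfE /volume; apply: contraTneq => ->.
by rewrite normr0 mul0r ltxx.
Qed.

Lemma bary_shift p i x y : bary p i y = bary p i x + dotv (bgrad p i) (y - x).
Proof. by rewrite /bary -addrA -dotvDr (addrC (x - _)) subrKA. Qed.

Lemma sum_bgrad p : \sum_i bgrad p i = 0.
Proof.
rewrite big_ord_recl {1}/bgrad unlift_none.
by under [X in _ + X]eq_bigr do rewrite /bgrad liftK; rewrite addNr.
Qed.

Lemma sum_bary p x : \sum_i bary p i x = 1.
Proof.
rewrite big_split /= -dotv_suml sum_bgrad dotvC dotv0r addr0 big_ord_recl.
by rewrite big1 ?addr0.
Qed.

Lemma dotv_bgrad_lift p k x :
  dotv (bgrad p (lift ord0 k)) x = (invmx (edge_mx p) *m x) k 0.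
Proof. by rewrite /bgrad liftK /dotv trmxK -row_mul mxE. Qed.

Lemma edge_mx_mul p (y : 'cV[R]_d) :
  edge_mx p *m y = \sum_k y k 0 *: (p (lift ord0 k) - p ord0).
Proof.
apply/matrixP => i j; rewrite ord1 mxE summxE; apply: eq_bigr => k _.
by rewrite !mxE mulrC.
Qed.

Lemma comb_sub (l : 'I_d.+1 -> R) p : \sum_i l i = 1 ->
  \sum_i l i *: p i - p ord0 = edge_mx p *m \col_k l (lift ord0 k).
Proof.
move=> l1; rewrite edge_mx_mul -[X in _ - X]scale1r -l1 scaler_suml -sumrB.
rewrite big_ord_recl subrr add0r.
by apply: eq_bigr => k _; rewrite mxE scalerBr.
Qed.

(** Barycentric coefficients are unique: subtracting p_0 turns those with
    index at least 1 into coordinates in the basis of edges, and the remaining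
    one follows since the coefficients sum to 1. *)
Lemma bary_comb (l : 'I_d.+1 -> R) p i : 0 < volume p -> \sum_i l i = 1 ->
  bary p i (\sum_k l k *: p k) = l i.
Proof.
move=> /volume_unitmx Eu l1; set z := \sum_k _.
have lift_case k : bary p (lift ord0 k) z = l (lift ord0 k).
  by rewrite /bary comb_sub// dotv_bgrad_lift mulKmx// mxE add0r.
case: (unliftP ord0 i) => [k|] ->; first exact: lift_case.
have := sum_bary p z; rewrite -[in RHS]l1 !big_ord_recl.
by under eq_bigr do rewrite lift_case; move/addIr.
Qed.

Lemma bary_vertex p i k : 0 < volume p -> bary p i (p k) = (i == k)%:R.
Proof.
move=> p0; rewrite -(bary_comb (l := fun i => (i == k)%:R) i p0).
  congr bary; rewrite (bigD1 k)//= eqxx scale1r big1 ?addr0// => j jk.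
  by rewrite (negPf jk) scale0r.
by rewrite (bigD1 k)//= eqxx big1 ?addr0// => j jk; rewrite (negPf jk).
Qed.

Lemma bary_recon p x : 0 < volume p -> \sum_i bary p i x *: p i = x.
Proof.
move=> /volume_unitmx Eu; apply: (addIr (- p ord0)).
rewrite comb_sub ?sum_bary// -[RHS](mulKVmx Eu); congr (_ *m _).
apply/matrixP => k j; rewrite ord1 mxE /bary dotv_bgrad_lift.
by rewrite -[_ == ord0]/false add0r.
Qed.

Lemma bary_affine (I : Type) (s : seq I) (P : pred I) p i (l : I -> R)
    (z : I -> 'cV[R]_d) : \sum_(k <- s | P k) l k = 1 ->
  bary p i (\sum_(k <- s | P k) l k *: z k) =
  \sum_(k <- s | P k) l k * bary p i (z k).
Proof.
move=> l1; under [RHS]eq_bigr do rewrite /bary mulrDr dotvBr mulrBr.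
rewrite big_split sumrB /= -!mulr_suml l1 !mul1r /bary dotvBr dotv_sumr.
congr (_ + (_ - _)); apply: eq_bigr => k _; exact: dotvZr.
Qed.

Lemma simplexE p x : 0 < volume p -> simplex p x <-> forall i, 0 <= bary p i x.
Proof.
move=> p0; split=> [[l [l0 l1 ->]] i|x0].
  move: l1; under eq_bigl do rewrite inE; move=> l1.
  by under eq_bigl do rewrite inE; rewrite bary_comb// l0 ?inE.
exists (fun i => bary p i x); split=> //.
  by under eq_bigl do rewrite inE; exact: sum_bary.
by under eq_bigl do rewrite inE; rewrite bary_recon.
Qed.

Lemma simplex_vertex p i : 0 < volume p -> simplex p (p i).
Proof. by move=> p0; apply/simplexE => // k; rewrite bary_vertex. Qed.

Lemma affine_bary p (v : 'cV[R]_d -> R) x : 0 < volume p ->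
  affine_on (simplex p) v -> simplex p x -> v x = \sum_i bary p i x * v (p i).
Proof.
move=> p0 [q [c vE]] px; rewrite vE// -[in LHS](bary_recon x p0) dotv_sumr.
rewrite -[X in _ + X]mul1r -(sum_bary p x) mulr_suml -big_split /=.
by apply: eq_bigr => i _; rewrite dotvZr -mulrDr vE//; apply: simplex_vertex.
Qed.

End Barycentric.

(** * Continuity of barycentric coordinates and gradients at the barycenter *)

Section BarycentricTopology.
Variables (R : realType) (d : nat).
Implicit Types (p : 'I_d.+1 -> 'cV[R]_d) (x y q : 'cV[R]_d).

Lemma cvg_dotv (T : Type) (F : set_system T) {FF : Filter F}
    (h : T -> 'cV[R]_d) q x :
  h t @[t --> F] --> x -> dotv q (h t) @[t --> F] --> dotv q x.
Proof.
move=> hx; rewrite dotvE; under eq_fun do rewrite dotvE.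
apply: cvg_big => [|i _]; first exact: add_continuous.
apply: cvgMl_tmp; apply: (@cvg_comp _ _ _ h (fun M => M i 0) _ _ _ hx).
exact: coord_continuous.
Qed.

Lemma cvg_bary (T : Type) (F : set_system T) {FF : Filter F}
    (h : T -> 'cV[R]_d) p i x :
  h t @[t --> F] --> x -> bary p i (h t) @[t --> F] --> bary p i x.
Proof.
rewrite /bary => hx; apply: cvgD; first exact: cvg_cst.
by apply: cvg_dotv; apply: cvgB => //; exact: cvg_cst.
Qed.

Lemma bary_continuous p i : continuous (bary p i).
Proof. by move=> x; exact: (@cvg_bary _ (nbhs x) _ id). Qed.

Lemma closed_simplex p : 0 < volume p -> closed (simplex p).
Proof.
move=> p0; rewrite (_ : simplex p = \bigcap_i bary p i @^-1` [set t | 0 <= t]).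
  apply: closed_bigI => i _; apply: closed_comp => [x _|].
    exact: bary_continuous.
  exact: closed_ge.
apply/seteqP; split=> x; first by move=> /simplexE + i _ => /(_ p0); apply.
by move=> x0; apply/simplexE => // i; apply: x0.
Qed.

Lemma grad_near_affine (v : 'cV[R]_d -> R) x q a :
  (\forall y \near x, v y = dotv q (y - x) + a) -> grad v x = q.
Proof.
move=> vE; apply/matrixP => i j; rewrite ord1 mxE /derive.
apply: cvg_lim => //; apply: cvg_near_cst.
have vxE := nbhs_singleton vE.
have cvg_line : (fun h : R => h *: delta_mx i 0 + x) @ 0^' --> x.
  rewrite -[X in _ --> X]add0r -[X in X + x](scale0r (delta_mx i 0 : 'cV[R]_d)).
  apply: cvgD; last exact: cvg_cst.
  apply: cvgZr_tmp; exact: nbhs_dnbhs.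
have lineE : \forall h \near (0 : R)^', v (h *: delta_mx i 0 + x) =
  dotv q (h *: delta_mx i 0 + x - x) + a := cvg_line _ vE.
near=> h.
have h0 : h != 0 by near: h; exact: nbhs_dnbhs_neq.
rewrite /= vxE (near lineE h)// addrK subrr dotv0r add0r addrK dotvZr dotv_delta.
exact: (mulKf h0).
Unshelve. all: by end_near. Qed.

Lemma bary_barycenter p i : 0 < volume p -> bary p i (barycenter p) = d.+1%:R^-1.
Proof.
move=> p0; rewrite /barycenter scaler_sumr bary_comb//.
by rewrite sumr_const card_ord -[LHS]mulr_natr mulVf ?pnatr_eq0.
Qed.

(** The gradient only sees v near the barycenter, where all barycentric
    coordinates stay positive, so that v is known there although nothing is
    assumed about it outside the simplex. *)
Lemma grad_barycenter p (a : 'I_d.+1 -> R) (v : 'cV[R]_d -> R) :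
    0 < volume p -> (forall x, simplex p x -> v x = \sum_i bary p i x * a i) ->
  grad v (barycenter p) = \sum_i a i *: bgrad p i.
Proof.
move=> p0 vE; set b := barycenter p.
apply: (@grad_near_affine _ _ _ (\sum_i bary p i b * a i)).
have : \forall y \near b, forall i, 0 < bary p i y.
  apply: (@filter_forall _ _ _ (nbhs b)) => i.
  apply: (cvgr_gt _ (@bary_continuous p i b)).
  by rewrite bary_barycenter// invr_gt0.
apply: (@filterS _ (nbhs b)) => y y0; rewrite vE; last first.
  by apply/simplexE => // i; exact: ltW.
rewrite dotv_suml -big_split/=; apply: eq_bigr => i _.
by rewrite dotvZl (bary_shift p i b y); ring.
Qed.

End BarycentricTopology.

(** * Gradients on an equilateral simplex *)

Section Equilateral.
Variables (R : realType) (d : nat).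
Implicit Types (p s : 'I_d.+1 -> 'cV[R]_d).

Lemma dotv_bgrad_vertex p i k m : 0 < volume p ->
  dotv (bgrad p i) (p k - p m) = (i == k)%:R - (i == m)%:R.
Proof.
move=> p0; rewrite -!(bary_vertex i _ p0) (bary_shift p i (p m) (p k)).
by rewrite addrAC subrr add0r.
Qed.

(** The edges leaving p_0 span the space, so their products with a vector
    determine it. *)
Lemma bgrad_unique p i q : 0 < volume p ->
    (forall k, dotv q (p k - p ord0) = (i == k)%:R - (i == ord0)%:R) ->
  q = bgrad p i.
Proof.
move=> p0 qE; apply/eqP; rewrite -subr_eq0; set z := q - _.
have zp k : dotv z (p k - p ord0) = 0.
  by rewrite dotvBl qE dotv_bgrad_vertex// subrr.
have zE : z = \sum_i bary p i (z + p ord0) *: (p i - p ord0).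
  under eq_bigr do rewrite scalerBr.
  by rewrite sumrB -scaler_suml sum_bary scale1r bary_recon// addrK.
rewrite -dotvv_eq0 {2}zE dotv_sumr big1// => k _.
by rewrite dotvZr zp mulr0.
Qed.

(** Polarization of the squared edge lengths L (1 - delta_ab): the product is
    half of |s_i - s_j|^2 + |s_i - s_k|^2 - |s_j - s_k|^2. *)
Lemma equilateral_dotv s : equilateral s ->
  exists L, forall i j k, dotv (s i - s j) (s i - s k) =
    L / 2 * (1 - (i == j)%:R - (i == k)%:R + (j == k)%:R).
Proof.
case=> l sl; exists (l ^+ 2) => i j k.
have sqE a b : dotv (s a - s b) (s a - s b) = l ^+ 2 * (1 - (a == b)%:R).
  case: eqVneq => [->|ab]; first by rewrite !subrr mulr0 dotv0r.
  by rewrite -(sl _ _ ab) sqr_sqrtr ?dotvv_ge0// subr0 mulr1.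
have := sqE i j; have := sqE i k; have := sqE j k.
rewrite !(dotvBl, dotvBr) (dotvC (s j) (s i)) (dotvC (s k) (s i)).
by rewrite (dotvC (s k) (s j)); lra.
Qed.

Lemma vertex_neq p i j : 0 < volume p -> i != j -> p i != p j.
Proof.
move=> p0; apply: contraNneq => pij; apply/eqP.
have := bary_vertex i i p0; rewrite eqxx pij bary_vertex//.
by case: eqVneq => // _ /eqP; rewrite eq_sym oner_eq0.
Qed.

Lemma sub_barycenter p i :
  p i - barycenter p = d.+1%:R^-1 *: \sum_k (p i - p k).
Proof.
rewrite sumrB sumr_const card_ord -(scaler_nat d.+1 (p i)) scalerBr scalerA.
by rewrite mulVf ?pnatr_eq0// scale1r.
Qed.

(** By symmetry the gradient of the i-th coordinate points from the
    barycenter to the i-th vertex; [bgrad_unique] reduces this to the products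
    given by [equilateral_dotv].  The dimension must be positive for a to be
    computed from the length of an edge. *)
Lemma bgrad_equilateral s : 0 < volume s -> equilateral s -> (0 < d)%N ->
  exists2 a, 0 < a & forall i, bgrad s i = a *: (s i - barycenter s).
Proof.
move=> s0 /equilateral_dotv[L sL] d0; have L0 : 0 < L.
  have := sL ord0 ord_max ord_max.
  have om : (ord0 == ord_max :> 'I_d.+1) = false by rewrite -val_eqE /= ltn_eqF.
  rewrite om eqxx !subr0 mulrDr mulr1 -splitr => <-.
  by rewrite lt_def dotvv_ge0 dotvv_eq0 subr_eq0 vertex_neq// om.
(* (s_i - barycenter).(s_i - s_m) is L/2 for m <> i, whence the factor 2/L. *)
exists (2 / L) => [|i]; first by rewrite divr_gt0.
have cE m : dotv (s i - barycenter s) (s i - s m) = L / 2 * (1 - (i == m)%:R).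
  rewrite sub_barycenter dotvZl dotv_suml; under eq_bigr do rewrite sL.
  have sum1 j : \sum_k (k == j)%:R = 1 :> R.
    by rewrite (bigD1 j)//= eqxx big1 ?addr0// => k /negPf->.
  under eq_bigr do rewrite (eq_sym i).
  rewrite -mulr_sumr big_split sumrB sumrB/= !sum1 !sumr_const card_ord.
  rewrite -[(i == m)%:R *+ _]mulr_natl; have := lt0r_neq0 (ltr0Sn R d).
  by move: (d.+1%:R : R) => D D0; field.
apply/esym/bgrad_unique => // k.
rewrite dotvZl -[s k - _](subrKA (s i)) dotvDr -(opprB (s i)) dotvNr !cE.
by field; rewrite gt_eqF.
Qed.

(** Along s_i - barycenter, the mean over k of s_i - s_k, the j-th coordinate
    decreases by 1 / (d + 1). *)
Lemma dotv_bgrad_equilateral_lt0 s i j : 0 < volume s -> equilateral s ->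
  i != j -> dotv (bgrad s i) (bgrad s j) < 0.
Proof.
move=> s0 seq ij; have d0 : (0 < d)%N.
  by case: d i j ij {s s0 seq} => // i j; rewrite !ord1.
have [a a0 sE] := bgrad_equilateral s0 seq d0.
rewrite {1}sE sub_barycenter dotvC !dotvZr dotv_sumr.
under eq_bigr do rewrite dotv_bgrad_vertex// (eq_sym j i) (negPf ij) sub0r.
rewrite (bigD1 j)//= eqxx big1 ?addr0 => [|k kj].
  by rewrite !mulrN mulr1 oppr_lt0 mulr_gt0// invr_gt0.
by rewrite eq_sym (negPf kj) oppr0.
Qed.

End Equilateral.

(** * Affine images of simplices and aligned diffusion matrices *)

Section AffineImage.
Variables (R : realType) (d : nat).
Implicit Types (p r s : 'I_d.+1 -> 'cV[R]_d) (B : 'M[R]_d) (c : 'cV[R]_d).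

Lemma affine_map_comb (I : Type) (t : seq I) (P : pred I) B c (l : I -> R)
    (z : I -> 'cV[R]_d) : \sum_(k <- t | P k) l k = 1 ->
  affine_map B c (\sum_(k <- t | P k) l k *: z k) =
  \sum_(k <- t | P k) l k *: affine_map B c (z k).
Proof.
move=> l1; rewrite /affine_map mulmx_sumr -[X in _ + X]scale1r -l1 scaler_suml.
by rewrite -big_split/=; apply: eq_bigr => k _; rewrite scalerDr scalemxAr.
Qed.

Lemma bary_le1 p i x : 0 < volume p -> simplex p x -> bary p i x <= 1.
Proof.
move=> p0 /(simplexE _ p0) x0; rewrite -(sum_bary p x) (bigD1 i)//= lerDl.
by apply: sumr_ge0 => k _; exact: x0.
Qed.

Lemma bary_eq1 p i x :
  0 < volume p -> simplex p x -> bary p i x = 1 -> x = p i.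
Proof.
move=> p0 /(simplexE _ p0) x0 x1; rewrite -[LHS](bary_recon x p0) (bigD1 i)//=.
rewrite x1 scale1r big1 ?addr0// => k ki.
have : \sum_(k | k != i) bary p k x = 0.
  apply: (addrI (bary p i x)); rewrite addr0 {2}x1 -(sum_bary p x).
  by rewrite [RHS](bigD1 i).
by move/psumr_eq0P => ->//; rewrite scale0r.
Qed.

(** Only the equality of the two sets is known, so the affine map may permute
    the vertices.  A vertex p_i is the image of a convex combination of the
    r_k, hence a convex combination of their images, on each of which the i-th
    barycentric coordinate is at most 1; as this coordinate is 1 at p_i, any
    r_k with a positive coefficient is sent to p_i. *)
Lemma affine_image_vertices B c r p : 0 < volume p ->
    affine_map B c @` simplex r = simplex p ->
  exists sg : 'I_d.+1 -> 'I_d.+1, forall i, p i = affine_map B c (r (sg i)).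
Proof.
move=> p0 rp; suff : forall i, exists k, p i = affine_map B c (r k).
  by move=> /boolp.choice[sg sgE]; exists sg.
move=> i; have : simplex p (p i) by exact: simplex_vertex.
rewrite -rp => -[x [l [l0 l1 ->]]]; rewrite affine_map_comb// => pE.
have imr k : simplex p (affine_map B c (r k)).
  rewrite -rp; exists (r k) => //; exists (fun j => (j == k)%:R); split=> //.
    by rewrite (bigD1 k) ?inE//= eqxx big1 ?addr0// => j /andP[_ /negPf->].
  rewrite (bigD1 k) ?inE//= eqxx scale1r big1 ?addr0// => j /andP[_ /negPf->].
  by rewrite scale0r.
have sum0 : \sum_(k in [set: 'I_d.+1]%SET)
    l k * (1 - bary p i (affine_map B c (r k))) = 0.
  under eq_bigr do rewrite mulrBr mulr1.
  by rewrite sumrB l1 -bary_affine// pE bary_vertex// eqxx subrr.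
have [k kin lk] : exists2 k, k \in [set: 'I_d.+1]%SET & l k != 0.
  apply/exists_inP; apply: contra_eqT l1 => /exists_inPn l0'.
  rewrite big1 ?(eq_sym 0) ?oner_eq0// => k kin.
  by apply/eqP; have := l0' k kin; rewrite negbK.
exists k; apply/esym/(bary_eq1 p0 (imr k)).
have term_ge0 j : j \in [set: 'I_d.+1]%SET ->
    0 <= l j * (1 - bary p i (affine_map B c (r j))).
  by move=> jin; rewrite mulr_ge0 ?l0// subr_ge0 bary_le1.
have /eqP := psumr_eq0P term_ge0 sum0 kin.
by rewrite mulf_eq0 (negPf lk)/= subr_eq0 => /eqP.
Qed.

Lemma affine_edge_mx B c r p : (forall i, p i = affine_map B c (r i)) ->
  edge_mx p = B *m edge_mx r.
Proof.
move=> pE; apply/matrixP => i j; rewrite !mxE !pE /affine_map !mxE.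
rewrite opprD addrACA subrr addr0 -sumrB.
by apply: eq_bigr => k _; rewrite mxE mulrBr.
Qed.

(** Chain rule: the i-th barycentric coordinate of r is that of p composed
    with the affine map. *)
Lemma affine_bgrad B c r p i : 0 < volume p ->
  (forall i, p i = affine_map B c (r i)) ->
  [/\ B \in unitmx, 0 < volume r & B^T *m bgrad p i = bgrad r i].
Proof.
move=> p0 pE; have := volume_unitmx p0; rewrite (affine_edge_mx pE) unitmx_mul.
case/andP => Bu ru; have r0 : 0 < volume r.
  rewrite /volume divr_gt0 ?ltr0n ?fact_gt0// normr_gt0.
  by rewrite -unitfE -unitmxE.
split=> //; apply: bgrad_unique => // k.
have -> : dotv (B^T *m bgrad p i) (r k - r ord0) =
    dotv (bgrad p i) (p k - p ord0).
  by rewrite -dotv_mulmxr mulmxBr !pE /affine_map opprD addrACA subrr addr0.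
exact: dotv_bgrad_vertex.
Qed.

End AffineImage.

(** Alignment is the equality case of [spd_trace_det_scalar] for
    C = B^T (th A^-1) B, so C = a I with a > 0; solving for A gives
    mu = th / a. *)
Lemma aligned_diffusion (R : realType) (d : nat) (A B : 'M[R]_d) (th : R) :
    (0 < d)%N -> 0 < th -> B \in unitmx -> spd (th *: invmx A) ->
    d%:R^-1 * \tr (B^T *m (th *: invmx A) *m B) =
      (\det (B^T *m (th *: invmx A) *m B)) `^ (d%:R^-1) ->
  exists2 mu, 0 < mu & A = mu *: (B *m B^T).
Proof.
move=> d0 th0 Bu Mspd al; set M := th *: invmx A in Mspd al.
have Cspd := spd_congr Bu Mspd; have [C0 _] := hadamard Cspd.
have [a aE] : exists a, B^T *m M *m B = a%:M.
  apply: spd_trace_det_scalar => //; rewrite mulrC al -powR_mulrn ?powR_ge0//.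
  by rewrite -powRrM mulVf ?pnatr_eq0 -?lt0n// powRr1// ltW.
have a0 : 0 < a.
  by have := spd_diag_gt0 (Ordinal d0) Cspd; rewrite aE mxE eqxx.
(* The convention invmx A = A for singular A makes A invertible as soon as
   invmx A is. *)
have Au : A \in unitmx.
  have := spd_unitmx Mspd; rewrite unitmxZ ?unitmx_inv// unitfE gt_eqF//.
exists (th / a); first by rewrite divr_gt0.
have BTu : B^T \in unitmx by rewrite unitmx_tr.
have MB : M *m B = a *: invmx B^T.
  by rewrite -(mulKmx BTu (M *m B)) (mulmxA B^T) aE mul_mx_scalar.
have AB : th *: B = a *: (A *m invmx B^T).
  by rewrite scalemxAr -MB -scalemxAl -scalemxAr mulKVmx.
rewrite mulrC -scalerA scalemxAl AB -scalemxAl mulmxKV// scalerA.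
by rewrite mulVf ?gt_eqF// scale1r.
Qed.

(** * Nodal functions of a mesh in barycentric form *)

Section Hat.
Variables (R : realType) (d : nat) (T : mesh R d).
Implicit Types (K : 'I_(nelt T)) (i : 'I_d.+1) (j k : 'I_(nvert T)).
Implicit Types (x y : 'cV[R]_d).

(** The barycentric coordinate of K at its vertex of global index j, and zero
    if j is not a vertex of K.  Being defined on the whole space, it extends
    the restriction of the basis function of j to K by an affine function; the
    global index lets coordinates of different elements be compared. *)
Definition hat K j x : R := \sum_(i | local K i == j) bary (eltv K) i x.

Definition hat_grad K j : 'cV[R]_d :=
  \sum_(i | local K i == j) bgrad (eltv K) i.

Lemma hat_sum (V : nmodType) (F : 'I_(nvert T) -> 'I_d.+1 -> V) K :
  \sum_j \sum_(i | local K i == j) F j i = \sum_i F (local K i) i.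
Proof.
rewrite [RHS](partition_big (local K) predT)//=; apply: eq_bigr => j _.
by apply: eq_bigr => i /eqP ->.
Qed.

Lemma sum_hat K x : \sum_j hat K j x = 1.
Proof. by rewrite hat_sum sum_bary. Qed.

Lemma sum_hat_grad K : \sum_j hat_grad K j = 0.
Proof. by rewrite hat_sum sum_bgrad. Qed.

Lemma hat_shift K j x y :
  hat K j y = hat K j x + dotv (hat_grad K j) (y - x).
Proof.
rewrite /hat dotv_suml -big_split; apply: eq_bigr => i _; exact: bary_shift.
Qed.

Lemma hat_affine (I : Type) (s : seq I) (P : pred I) (l : I -> R)
    (z : I -> 'cV[R]_d) K j : \sum_(k <- s | P k) l k = 1 ->
  hat K j (\sum_(k <- s | P k) l k *: z k) =
  \sum_(k <- s | P k) l k * hat K j (z k).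
Proof.
move=> l1; rewrite /hat; under eq_bigr do rewrite bary_affine//.
by rewrite exchange_big/=; apply: eq_bigr => k _; rewrite mulr_sumr.
Qed.

Lemma hat_line K j x y (t : R) :
  hat K j (x + t *: (y - x)) = (1 - t) * hat K j x + t * hat K j y.
Proof.
rewrite (hat_shift K j x (_ + _)) (hat_shift K j x y) addrAC subrr add0r dotvZr.
by ring.
Qed.

Lemma cvg_hat (S : Type) (F : set_system S) {FF : Filter F}
    (h : S -> 'cV[R]_d) K j x :
  h t @[t --> F] --> x -> hat K j (h t) @[t --> F] --> hat K j x.
Proof.
move=> hx; apply: cvg_big => [|i _]; first exact: add_continuous.
exact: cvg_bary.
Qed.

Lemma hat_continuous K j : continuous (hat K j).
Proof. by move=> x; exact: (@cvg_hat _ (nbhs x) _ id). Qed.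

Lemma hat_notin K j x : j \notin vset K -> hat K j x = 0.
Proof.
move=> jK; rewrite /hat big_pred0// => i; apply: contraNF jK => /eqP <-.
exact: imset_f.
Qed.

Lemma hat_grad_notin K j : j \notin vset K -> hat_grad K j = 0.
Proof.
move=> jK; rewrite /hat_grad big_pred0// => i; apply: contraNF jK => /eqP <-.
exact: imset_f.
Qed.

Section Nondegenerate.
Variables (Omega : set 'cV[R]_d) (hT : triangulation Omega T).

Lemma local_inj K : injective (local K).
Proof.
move=> i i' ii'; apply/eqP; apply: contraT => ni.
by have := vertex_neq (elt_nondegenerate hT K) ni; rewrite /eltv ii' eqxx.
Qed.

Lemma hat_local K i x : hat K (local K i) x = bary (eltv K) i x.
Proof.
by rewrite /hat (big_pred1 i)// => i' /=; rewrite (inj_eq (@local_inj K)).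
Qed.

Lemma hat_grad_local K i : hat_grad K (local K i) = bgrad (eltv K) i.
Proof.
by rewrite /hat_grad (big_pred1 i)// => i' /=; rewrite (inj_eq (@local_inj K)).
Qed.

Lemma hat_vertex K j k : k \in vset K -> hat K j (vertex k) = (j == k)%:R.
Proof.
case/imsetP => i _ ->; have [/imsetP[i' _ ->]|jK] := boolP (j \in vset K).
  rewrite hat_local (bary_vertex _ _ (elt_nondegenerate hT K)).
  by rewrite (inj_eq (@local_inj K)).
rewrite hat_notin//; case: eqVneq => // jE; move: jK; rewrite jE.
by rewrite imset_f.
Qed.

Lemma hat_recon K x : \sum_j hat K j x *: vertex j = x.
Proof.
under eq_bigr do rewrite scaler_suml; rewrite hat_sum.
exact: (bary_recon x (elt_nondegenerate hT K)).
Qed.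

Lemma eltP K x : elt K x <-> forall j, 0 <= hat K j x.
Proof.
have K0 := elt_nondegenerate hT K; split=> [/(simplexE _ K0) x0 j|x0].
  by apply: sumr_ge0 => i _; exact: x0.
by apply/simplexE => // i; rewrite -hat_local.
Qed.

Lemma elt_vertex K j : j \in vset K -> elt K (vertex j).
Proof. by move=> jK; apply/eltP => k; rewrite hat_vertex. Qed.

Lemma hat_hull K (S : {set 'I_(nvert T)}) (l : 'I_(nvert T) -> R) j :
    S \subset vset K -> \sum_(k in S) l k = 1 ->
  hat K j (\sum_(k in S) l k *: vertex k) = if j \in S then l j else 0.
Proof.
move=> SK l1; rewrite hat_affine//.
rewrite (eq_bigr (fun k => l k * (j == k)%:R)) => [|k kS]; last first.
  by rewrite hat_vertex// (fintype.subsetP SK).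
case: ifPn => jS; last first.
  rewrite big1// => k kS; case: eqVneq => [jk|_]; last exact: mulr0.
  by rewrite jk kS in jS.
rewrite (bigD1 j)//= eqxx mulr1 big1 ?addr0// => k /andP[_ kj].
by rewrite eq_sym (negPf kj) mulr0.
Qed.

(** This is where conformity enters: a common point is a combination of
    common vertices, and its coefficients are the coordinates in both
    elements. *)
Lemma hat_agree K K' x j : elt K x -> elt K' x -> hat K j x = hat K' j x.
Proof.
move=> Kx K'x; have : (elt K `&` elt K') x by [].
rewrite (elt_conforming hT) => -[l [_ l1 ->]].
by rewrite !hat_hull// ?finset.subsetIl ?finset.subsetIr.
Qed.

(** A mesh vertex that lies in an element is one of its vertices, since it has
    coordinate 1 in any element that uses it: there are no hanging nodes. *)
Lemma elt_vertexP K j : elt K (vertex j) <-> j \in vset K.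
Proof.
split; last exact: elt_vertex.
have [K' jK'] := vertex_used hT j; move=> Kj.
have := hat_agree j Kj (elt_vertex jK'); rewrite [RHS]hat_vertex// eqxx.
by apply: contra_eqT => /hat_notin ->; rewrite eq_sym oner_eq0.
Qed.

End Nondegenerate.
End Hat.

(** * Finite element functions *)

Section FiniteElementFunctions.
Variables (R : realType) (d : nat) (Omega : set 'cV[R]_d) (T : mesh R d).
Variable hT : triangulation Omega T.
Variable phi : 'I_(nvert T) -> 'cV[R]_d -> R.
Hypothesis hphi : nodal_basis Omega phi.
Implicit Types (K : 'I_(nelt T)) (j k : 'I_(nvert T)) (u : 'I_(nvert T) -> R).

Lemma nodal_basis_hat K j x : elt K x -> phi j x = hat K j x.
Proof.
have [_ phiK phi1] := hphi j => Kx.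
rewrite (affine_bary (elt_nondegenerate hT K) (phiK K) Kx) /hat [RHS]big_mkcond.
by apply: eq_bigr => i _; rewrite phi1; case: ifP; rewrite (mulr1, mulr0).
Qed.

Lemma fe_fun_hat K u x : elt K x -> fe_fun phi u x = \sum_j u j * hat K j x.
Proof. by move=> Kx; apply: eq_bigr => j _; rewrite (nodal_basis_hat j Kx). Qed.

Lemma fe_fun_vertex u j : fe_fun phi u (vertex j) = u j.
Proof.
have phi1 k i : phi k (vertex i) = (i == k)%:R by have [_ _ ->] := hphi k.
rewrite /fe_fun (bigD1 j)//= big1 => [|k kj]; rewrite phi1.
  by rewrite eqxx mulr1 addr0.
by rewrite eq_sym (negPf kj) mulr0.
Qed.

Lemma fe_fun_delta j : fe_fun phi (fun k => (k == j)%:R) = phi j.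
Proof.
apply/funext => x; rewrite /fe_fun (bigD1 j)//= eqxx mul1r big1 ?addr0// => k.
by move=> /negPf->; rewrite mul0r.
Qed.

Lemma elt_grad_fe_fun u K :
  elt_grad (fe_fun phi u) K = \sum_j u j *: hat_grad K j.
Proof.
rewrite /elt_grad (grad_barycenter (a := fun i => u (local K i))
  (elt_nondegenerate hT K)) => [|x Kx].
  rewrite -(hat_sum (fun j i => u j *: bgrad (eltv K) i)).
  by apply: eq_bigr => j _; rewrite scaler_sumr.
rewrite (fe_fun_hat u Kx) -(hat_sum (fun j i => bary (eltv K) i x * u j)).
by apply: eq_bigr => j _; rewrite mulrC mulr_suml.
Qed.

Lemma elt_grad_nodal_basis j K : elt_grad (phi j) K = hat_grad K j.
Proof.
rewrite -fe_fun_delta elt_grad_fe_fun (bigD1 j)//= eqxx scale1r big1 ?addr0//.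
by move=> k /negPf->; rewrite scale0r.
Qed.

Lemma nodal_basis_U0 j : (j < nivert T)%N -> U0 phi (phi j).
Proof.
move=> jint; exists (fun k => (k == j)%:R); apply/funext => x.
rewrite (bigD1 j)//= eqxx mul1r big1 ?addr0// => k /andP[_ /negPf->].
exact: mul0r.
Qed.

End FiniteElementFunctions.

(** * The star of an interior vertex *)

Section Star.
Variables (R : realType) (d : nat) (Omega : set 'cV[R]_d) (T : mesh R d).
Variable hT : triangulation Omega T.
Implicit Types (K : 'I_(nelt T)) (j k : 'I_(nvert T)).

(** Near a_j the domain is covered by elements, and only by elements having
    a_j as a vertex, since the others are closed and avoid a_j.  So every ray
    from a_j starts inside an element of the star. *)
Lemma star_ray j y : open Omega -> Omega (vertex j) ->
  exists K (t : R),
    [/\ j \in vset K, 0 < t & elt K (vertex j + t *: (y - vertex j))].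
Proof.
move=> Oo Oj; set a := vertex j.
have near_star : \forall z \near a, forall K, elt K z -> j \in vset K.
  apply: (@filter_forall _ _ _ (nbhs a)) => K.
  have [jK|jK] := boolP (j \in vset K); first by apply: nearW.
  have [i ia] : exists i, hat K i a < 0.
    apply: contrapT => a0; move/negP: jK; apply; apply/(elt_vertexP hT).
    apply/(eltP hT) => i; rewrite leNgt; apply/negP => ia; apply: a0.
    by exists i.
  have : \forall z \near a, hat K i z < 0.
    exact: (cvgr_lt _ (@hat_continuous _ _ _ K i a)).
  apply: (@filterS _ (nbhs a)) => z zi Kz.
  by have /(eltP hT)/(_ i) := Kz; rewrite leNgt zi.
have near_cover : \forall z \near a, exists K, elt K z.
  have : \forall z \near a, Omega z by apply: open_nbhs_nbhs; split.
  apply: (@filterS _ (nbhs a)) => z /(@subset_closure _ Omega).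
  by rewrite -(elt_cover hT) => -[K _ Kz]; exists K.
have ray : (fun t : R => a + t *: (y - a)) @ (0 : R)^'+ --> a.
  rewrite -[X in _ --> X]addr0 -(scale0r (y - a)).
  apply: cvgD; first exact: cvg_cst.
  by apply: cvgZr_tmp; apply: cvg_at_right_filter; exact: cvg_id.
have near_ray : \forall t \near (0 : R)^'+, [/\ 0 < t,
    (exists K, elt K (a + t *: (y - a))) &
    (forall K, elt K (a + t *: (y - a)) -> j \in vset K)].
  near=> t; split.
  - by near: t; exact: nbhs_right_gt.
  - by near: t; exact: ray near_cover.
  - by near: t; exact: ray near_star.
have [t [t0 [K Kt] jK]] := filter_ex near_ray.
by exists K, t; split=> //; exact: jK Kt.
Unshelve. all: by end_near. Qed.

(** Moving from a_j in the direction q stays inside an element of the star for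
    a while and increases the linear form q, which on that element is bounded
    by its largest value at a vertex. *)
Lemma star_ascent j q : open Omega -> Omega (vertex j) -> q != 0 ->
  exists K k, [/\ j \in vset K, k \in vset K &
    dotv q (vertex j) < dotv q (vertex k)].
Proof.
move=> Oo Oj q0; have [K [t [jK t0 Kz]]] := star_ray (vertex j + q) Oo Oj.
move: Kz; rewrite addrAC subrr add0r; set z := _ + _ => Kz.
apply: contrapT => nk; have : dotv q (vertex j) < dotv q z.
  by rewrite dotvDr ltrDl dotvZr mulr_gt0// lt_def dotvv_ge0 dotvv_eq0 q0.
apply/negP; rewrite -leNgt -[X in dotv q X](hat_recon hT K z) dotv_sumr.
rewrite -[leRHS]mul1r -(sum_hat K z) mulr_suml; apply: ler_sum => k _.
rewrite dotvZr; have [kK|/hat_notin->] := boolP (k \in vset K); last first.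
  by rewrite !mul0r.
apply: ler_wpM2l; first by have /(eltP hT) := Kz; apply.
by rewrite leNgt; apply/negP => jk; apply: nk; exists K, k.
Qed.

(** The basis function of a_j is positive only at interior points.  By
    [star_ray] a point y lies in the cone with apex a_j over some element K' of
    the star, which means that the coordinates of y in K' other than the j-th
    are nonnegative.  If y is close enough to x, then so is the j-th one:
    either x lies outside the closed cone of K', and so does y, or the segment
    from a_j to x starts in K and K' together, and then [hat_agree] shows that
    the j-th coordinates of x in K and K' coincide, so that the one in K' is
    positive at x and hence at y.  Thus a neighbourhood of x is covered by
    elements, and x belongs to the interior of the closure of the domain. *)
Lemma open_star_sub j K x : open Omega -> interior (closure Omega) `<=` Omega ->
  Omega (vertex j) -> elt K x -> 0 < hat K j x -> Omega x.
Proof.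
move=> Oo Oreg Oj Kx xj; apply: Oreg; set a := vertex j in Oj.
have near_cone : \forall y \near x, forall K', j \in vset K' ->
    (forall i, i != j -> 0 <= hat K' i y) -> elt K' y.
  apply: (@filter_forall _ _ _ (nbhs x)) => K'.
  have [jK'|jK'] := boolP (j \in vset K'); last first.
    by apply: nearW => y jK; case/negP: jK'.
  have [x0|] := pselect (forall i, i != j -> 0 <= hat K' i x); last first.
    move=> nx; have [i ij ix] : exists2 i, i != j & hat K' i x < 0.
      apply: contrapT => ni; apply: nx => i ij; rewrite leNgt; apply/negP => ix.
      by apply: ni; exists i.
    have : \forall y \near x, hat K' i y < 0.
      exact: (cvgr_lt _ (@hat_continuous _ _ _ K' i x)).
    apply: (@filterS _ (nbhs x)) => y yi _ /(_ i ij).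
    by rewrite leNgt yi.
  have jK : j \in vset K by apply: contraTT xj => /hat_notin->; rewrite ltxx.
  (* A point of the segment that is in both elements: this t is small enough
     for 1 - t + t h >= 0, where h is the j-th coordinate of x in K'. *)
  pose t := (1 + `|hat K' j x|)^-1.
  have t_gt0 : 0 < t by rewrite invr_gt0 ltr_pwDl.
  have t_le1 : t <= 1 by rewrite invf_le1 ?ltr_pwDl// lerDl.
  pose z := a + t *: (x - a).
  have hatz K1 i : j \in vset K1 ->
      hat K1 i z = (1 - t) * (i == j)%:R + t * hat K1 i x.
    by move=> jK1; rewrite hat_line (hat_vertex hT).
  have Kz : elt K z.
    apply/(eltP hT) => i; rewrite hatz// addr_ge0// mulr_ge0//.
    - by rewrite subr_ge0.
    - exact: ltW.
    - by have /(eltP hT) := Kx; apply.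
  have K'z : elt K' z.
    apply/(eltP hT) => i; rewrite hatz//; have [->|ij] := eqVneq i j.
      rewrite mulr1 -(pmulr_rge0 _ (_ : 0 < 1 + `|hat K' j x|)) ?ltr_pwDl//.
      have -> : (1 + `|hat K' j x|) * (1 - t + t * hat K' j x) =
          `|hat K' j x| + hat K' j x.
        by rewrite /t; field; rewrite gt_eqF// ltr_pwDl.
      by rewrite -lerBlDr sub0r -normrN ler_norm.
    by rewrite mulr0 add0r mulr_ge0 ?x0// ltW.
  have xj' : 0 < hat K' j x.
    have := hat_agree hT j Kz K'z; rewrite !hatz// => /addrI.
    by move/(mulfI (lt0r_neq0 t_gt0)) => <-.
  have : \forall y \near x, 0 < hat K' j y.
    exact: (cvgr_gt _ (@hat_continuous _ _ _ K' j x)).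
  apply: (@filterS _ (nbhs x)) => y yj _ y0; apply/(eltP hT) => i.
  by have [->|/y0//] := eqVneq i j; exact: ltW.
rewrite -(elt_cover hT); move: near_cone.
apply: (@filterS _ (nbhs x)) => y ycone.
have [K' [t [jK' t0 K'z]]] := star_ray y Oo Oj.
exists K' => //; apply: ycone => // i ij; have /(eltP hT)/(_ i) := K'z.
by rewrite hat_line (hat_vertex hT)// (negPf ij) mulr0 add0r pmulr_rge0.
Qed.

End Star.

(** A finite union of simplices is closed, so the closure of its interior adds
    nothing outside it. *)
Lemma polytopal_domain_regular (R : realType) (d : nat) (Omega : set 'cV[R]_d) :
  polytopal_domain Omega -> open Omega /\ interior (closure Omega) `<=` Omega.
Proof.
case=> _ _ [n [p [p0 ->]]]; split; first exact: open_interior.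
apply: interiorS;
have /closure_id {2}-> : closed (\bigcup_i simplex (p i)).
  by apply: closed_bigcup => [|i _]; [exact: finite_finset|exact: closed_simplex].
exact: closureS (@interior_subset _ _).
Qed.

(** * The discrete maximum principle *)

Definition strongly_acute (R : realType) (d : nat) (T : mesh R d)
    (A : 'I_(nelt T) -> 'M[R]_d) : Prop :=
  forall K j k, j \in vset K -> k \in vset K -> j != k ->
    dotv (hat_grad K j) (A K *m hat_grad K k) < 0.

Section MaximumPrinciple.
Variables (R : realType) (d : nat) (Omega : set 'cV[R]_d) (T : mesh R d).
Variable hT : triangulation Omega T.
Variable phi : 'I_(nvert T) -> 'cV[R]_d -> R.
Hypothesis hphi : nodal_basis Omega phi.
Implicit Types (K : 'I_(nelt T)) (j k : 'I_(nvert T)) (u : 'I_(nvert T) -> R).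

(** Since the gradients of the coordinates of an element sum to zero, u may be
    replaced by u - u_j.  The term of j then drops out and every other one is a
    product of two numbers that are at most 0, while the sum is at most 0; so
    all terms vanish, and the strict sign of the stiffness entry forces
    u_k = u_j. *)
Lemma max_at_neighbours A u j : strongly_acute A ->
    \sum_K elt_vol K *
      dotv (hat_grad K j) (A K *m elt_grad (fe_fun phi u) K) <= 0 ->
    (forall k, u k <= u j) ->
  forall K k, j \in vset K -> k \in vset K -> u k = u j.
Proof.
move=> acute le0 uj K k jK kK.
have energyE K1 : dotv (hat_grad K1 j) (A K1 *m elt_grad (fe_fun phi u) K1) =
    \sum_i (u i - u j) * dotv (hat_grad K1 j) (A K1 *m hat_grad K1 i).
  rewrite (elt_grad_fe_fun hT hphi) mulmx_sumr dotv_sumr.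
  under eq_bigr do rewrite -scalemxAr dotvZr.
  under [RHS]eq_bigr do rewrite mulrBl.
  rewrite sumrB -[LHS]subr0; congr (_ - _); rewrite -mulr_sumr -dotv_sumr.
  by rewrite -mulmx_sumr sum_hat_grad mulmx0 dotv0r mulr0.
have term_ge0 K1 i :
    0 <= (u i - u j) * dotv (hat_grad K1 j) (A K1 *m hat_grad K1 i).
  have [->|ij] := eqVneq i j; first by rewrite subrr mul0r.
  have [jK1|/hat_grad_notin->] := boolP (j \in vset K1); last first.
    by rewrite dotvC dotv0r mulr0.
  have [iK1|/hat_grad_notin->] := boolP (i \in vset K1); last first.
    by rewrite mulmx0 dotv0r mulr0.
  by rewrite mulr_le0 ?subr_le0// ltW// acute// eq_sym.
have elt_ge0 K1 : 0 <= elt_vol K1 *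
    dotv (hat_grad K1 j) (A K1 *m elt_grad (fe_fun phi u) K1).
  by rewrite energyE mulr_ge0 ?sumr_ge0// ltW// (elt_nondegenerate hT).
have sum0 : \sum_K1 elt_vol K1 *
    dotv (hat_grad K1 j) (A K1 *m elt_grad (fe_fun phi u) K1) = 0.
  by apply/le_anti; rewrite le0 sumr_ge0.
have /eqP termK0 := @psumr_eq0P _ _ xpredT _ (fun K1 _ => elt_ge0 K1) sum0 K isT.
move: termK0; rewrite mulf_eq0 gt_eqF ?(elt_nondegenerate hT)//= energyE.
move=> /eqP sumK0.
have [<-//|jk] := eqVneq j k.
have /eqP termk0 :=
  @psumr_eq0P _ _ xpredT _ (fun i _ => term_ge0 K i) sumK0 k isT.
move: termk0; rewrite mulf_eq0 (lt_eqF (acute K j k jK kK jk)) orbF.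
by rewrite subr_eq0 => /eqP.
Qed.

(** A vertex chosen among the maximizers of u as the furthest in the direction
    of the first axis cannot be interior: by [max_at_neighbours] the neighbour
    given by [star_ascent] would be a maximizer lying further. *)
Lemma max_at_boundary_vertex A u : (0 < d)%N -> open Omega ->
    Omega !=set0 -> strongly_acute A ->
    (forall j : 'I_(nvert T), (j < nivert T)%N -> \sum_K elt_vol K *
      dotv (hat_grad K j) (A K *m elt_grad (fe_fun phi u) K) <= 0) ->
  exists2 j : 'I_(nvert T), (nivert T <= j)%N & forall k, u k <= u j.
Proof.
move=> d0 Oo [x Ox] acute le0; have j0 : 'I_(nvert T).
  have := subset_closure Ox; rewrite -(elt_cover hT) => /cid2[K _ _].
  exact: local K ord0.
pose e : 'cV[R]_d := delta_mx (Ordinal d0) 0.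
have e0 : e != 0.
  apply/eqP => /matrixP/(_ (Ordinal d0) 0); rewrite !mxE !eqxx => /eqP.
  by rewrite oner_eq0.
have [jm _ jmP] := @arg_maxP _ _ _ j0 xpredT u isT.
have [j /eqP uj jP] := @arg_maxP _ _ _ jm (fun k => u k == u jm)
  (fun k => dotv e (vertex k)) (eqxx _).
have umax k : u k <= u j by rewrite uj; exact: jmP.
exists j => //; rewrite leqNgt; apply/negP => jint.
have [K [k [jK kK]]] := star_ascent hT Oo (vertex_interior hT jint) e0.
apply/negP; rewrite -leNgt; apply: jP; apply/eqP; rewrite -uj.
exact: (max_at_neighbours acute (le0 _ jint) umax jK kK).
Qed.

Lemma max_principle_boundary_vertex u j : (nivert T <= j)%N ->
  (forall k, u k <= u j) -> max_principle Omega (fe_fun phi u).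
Proof.
move=> jb uj; have bj := vertex_boundary hT jb.
have le_uj x : closure Omega x -> fe_fun phi u x <= u j.
  rewrite -(elt_cover hT) => -[K _ Kx]; rewrite (fe_fun_hat hT hphi u Kx).
  rewrite -[leRHS]mulr1 -(sum_hat K x) mulr_sumr; apply: ler_sum => k _.
  by apply: ler_wpM2r => //; have /(eltP hT) := Kx; apply.
exists (u j), (u j); split; last by rewrite le_max lexx orbT.
  split; first by exists (vertex j); [right|rewrite (fe_fun_vertex hphi)].
  by move=> x [/subset_closure|[xO _]]; exact: le_uj.
split; first by exists (vertex j) => //; rewrite (fe_fun_vertex hphi).
by move=> x [xO _]; exact: le_uj.
Qed.

(** At a quadrature node the basis function is either zero or positive, and in
    the latter case the node lies in the domain, where f has a sign. *)
Lemma load_le0 (B : 'I_(nelt T) -> 'M[R]_d) (c : 'I_(nelt T) -> 'cV[R]_d)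
    (m : nat) (w : 'I_m -> R) (bhat : 'I_m -> 'cV[R]_d) (f : 'cV[R]_d -> R) j :
    open Omega -> interior (closure Omega) `<=` Omega ->
    (forall q, 0 <= w q) -> (forall K q, elt K (qnode B c bhat K q)) ->
    (forall x, Omega x -> f x <= 0) -> (j < nivert T)%N ->
  \sum_(K < nelt T) elt_vol K *
    \sum_q w q * f (qnode B c bhat K q) * phi j (qnode B c bhat K q) <= 0.
Proof.
move=> Oo Oreg w0 qK f0 jint; apply: sumr_le0 => K _.
apply: mulr_ge0_le0; first exact/ltW/(elt_nondegenerate hT).
apply: sumr_le0 => q _.
rewrite (nodal_basis_hat hT hphi j (qK K q)); set x := qnode _ _ _ _ _.
have := (eltP hT K x).1 (qK K q) j; rewrite le_eqVlt => /predU1P[<-|xj].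
  by rewrite mulr0.
apply: mulr_le0_ge0; last exact: ltW.
apply: mulr_ge0_le0 => //; apply: f0.
exact: (open_star_sub hT Oo Oreg (vertex_interior hT jint) (qK K q) xj).
Qed.

End MaximumPrinciple.

(** With A_K = mu B B^T, the A_K product of two gradients is mu times the
    product of their pullbacks by B^T, and these are the gradients on the
    reference simplex with its vertices suitably numbered. *)
Lemma M_uniform_strongly_acute (R : realType) (d : nat) (Omega : set 'cV[R]_d)
    (T : mesh R d) (r : 'I_d.+1 -> 'cV[R]_d) (B : 'I_(nelt T) -> 'M[R]_d)
    (c : 'I_(nelt T) -> 'cV[R]_d) (theta : 'I_(nelt T) -> R)
    (A : 'I_(nelt T) -> 'M[R]_d) :
    (0 < d)%N -> triangulation Omega T -> equilateral r ->
    (forall K, affine_map (B K) (c K) @` simplex r = elt K) ->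
    (forall K, 0 < theta K) ->
    M_uniform (fun K => theta K *: invmx (A K)) B ->
  strongly_acute A.
Proof.
move=> d0 hT req hF th0 [Mspd _ al] K j k /imsetP[i _ ->] /imsetP[i' _ ->] ii'.
have K0 := elt_nondegenerate hT K.
have {}ii' : i != i' by apply: contraNneq ii' => ->.
have [sg pE] := affine_image_vertices K0 (hF K).
have sg_inj : injective sg.
  move=> a b ab; apply/eqP; apply: contraT => nab.
  by have := vertex_neq K0 nab; rewrite /elt_vol !pE ab eqxx.
have [Bu s0 gE] := affine_bgrad i K0 pE; have [_ _ gE'] := affine_bgrad i' K0 pE.
have [mu mu0 ->] := aligned_diffusion d0 (th0 K) Bu (Mspd K) (al K).
rewrite !(hat_grad_local hT) -scalemxAl dotvZr -mulmxA dotv_mulmxr.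
rewrite [in X in dotv X]gE gE' pmulr_rlt0//.
apply: dotv_bgrad_equilateral_lt0 => //; have [l rl] := req; exists l => a b ab.
by apply: rl; rewrite (inj_eq sg_inj).
Qed.

Theorem theorem3p1 (R : realType) (d : nat) (hd : (1 <= d <= 3)%N)
    (Omega : set 'cV[R]_d) (hOmega : polytopal_domain Omega)
    (f g : 'cV[R]_d -> R)
    (D : 'cV[R]_d -> 'M[R]_d) (hD : forall x, Omega x -> spd (D x))
    (r : 'I_d.+1 -> 'cV[R]_d)
    (r_equilateral : equilateral r) (r_unit : volume r = 1)
    (m : nat) (w : 'I_m -> R) (bhat : 'I_m -> 'cV[R]_d)
    (w_ge0 : forall k, 0 <= w k) (w_sum : \sum_k w k = 1)
    (bhat_in : forall k, simplex r (bhat k))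
    (T : mesh R d) (hT : triangulation Omega T)
    (phi : 'I_(nvert T) -> 'cV[R]_d -> R) (hphi : nodal_basis Omega phi)
    (B : 'I_(nelt T) -> 'M[R]_d) (c : 'I_(nelt T) -> 'cV[R]_d)
    (hF : forall K, affine_map (B K) (c K) @` simplex r = elt K)
    (theta : 'I_(nelt T) -> R) (theta_gt0 : forall K, 0 < theta K)
    (hM : M_uniform
       (fun K => theta K *: invmx (avg_diffusion B c w bhat D K)) B) :
  satisfies_DMP Omega phi B c w bhat D f g.
Proof.
have d0 : (0 < d)%N by case/andP: hd.
have [Oo Oreg] := polytopal_domain_regular hOmega; have [ne0 _ _] := hOmega.
have acute := M_uniform_strongly_acute d0 hT r_equilateral hF theta_gt0 hM.
move=> f0 u [_ uE].
have qK K k : elt K (qnode B c bhat K k) by rewrite -hF; exists (bhat k).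
have test (j : 'I_(nvert T)) : (j < nivert T)%N ->
    \sum_K elt_vol K * dotv (hat_grad K j)
      (avg_diffusion B c w bhat D K *m elt_grad (fe_fun phi u) K) <= 0.
  move=> jint; have := uE _ (nodal_basis_U0 phi jint).
  under eq_bigr do rewrite (elt_grad_nodal_basis hT hphi).
  by move=> ->; exact: (load_le0 hT hphi).
have [j jb uj] := max_at_boundary_vertex hT hphi d0 Oo ne0 acute test.
exact: (max_principle_boundary_vertex hT hphi jb uj).
Qed.
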